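(* There exists a surjective continuous map $f\colon [0,1]\to[0,1]$ with positive topological entropy such that for every $n\in\mathbb{N}$ and every closed set $X\subset[0,1]$ that is $f^n$-invariant, the map $f^n|_X\colon X\to X$ is not topologically conjugate to the full shift dynamical system $(\Sigma_2,\sigma)$.
   Context: $\mathbb{N}$ denotes the positive integers and $f^n$ the $n$-fold composition of $f$. A set $X$ is $f^n$-invariant if $f^n(X)\subset X$. $(\Sigma_2,\sigma)$ is the one-sided full shift on two symbols: $\Sigma_2=\{0,1\}^{\mathbb{N}}$ with the product topology (discrete topology on $\{0,1\}$), and $\sigma(w_1w_2w_3\cdots)=w_2w_3\cdots$. Two continuous maps $S\colon X\to X$ and $T\colon Y\to Y$ of compact metric spaces are topologically conjugate if there is a homeomorphism $\phi\colon X\to Y$ with $\phi\circ S=T\circ\phi$. Topological entropy is the usual one for continuous self-maps of compact metric spaces. *)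

(* Defs.v *)
From mathcomp Require Import all_boot all_order all_algebra finmap.
From mathcomp Require Import all_classical all_reals all_analysis.

Set Implicit Arguments.
Unset Strict Implicit.
Unset Printing Implicit Defensive.

Import Order.TTheory GRing.Theory Num.Theory.
Import numFieldNormedType.Exports.

Local Open Scope classical_set_scope.
Local Open Scope ring_scope.

Definition unit_interval (R : realType) : pseudoMetricType R :=
  set_type (`[0, 1] : set R).

Definition homeomorphism (X Y : topologicalType) (phi : X -> Y) : Prop :=
  continuous phi /\
  exists psi : Y -> X, [/\ continuous psi, cancel phi psi & cancel psi phi].

Definition topologically_conjugate (X Y : topologicalType)
    (S : X -> X) (T : Y -> Y) : Prop :=
  exists phi : X -> Y, homeomorphism phi /\ phi \o S = T \o phi.

Definition restrict_map (T : Type) (g : T -> T) (X : set T)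
    (gX : g @` X `<=` X) : X -> X :=
  fun x => SigSub (mem_set (gX _ (imageP g (set_valP x)))).

Definition full_shift (w : cantor_space) : cantor_space := fun k => w k.+1.

Section TopologicalEntropy.
Context {R : realType} {T : pseudoMetricType R}.
Local Open Scope ereal_scope.
Implicit Types (f : T -> T) (n : nat) (e : R) (A : {fset T}).

(* (n, e)-separated sets in Bowen's sense: since [ball x e] is
   {y | d(x, y) < e}, distinct points are at distance at least e for the metric
   max_(i < n) d(f^i x, f^i y). *)
Definition orbit_separated f n e A : Prop :=
  forall x y, x \in A -> y \in A -> x != y ->
    exists2 i, (i < n)%N & ~ ball (iter i f x) e (iter i f y).

Definition max_separated f n e : \bar R :=
  ereal_sup [set (#|` A|%:R)%:E | A in orbit_separated f n e].

Definition separated_growth f e : \bar R :=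
  limn_esup (fun n => (n%:R^-1)%:E * lne (max_separated f n e)).

(* The supremum over e > 0 is the usual limit as e tends to 0, as shown by
   [topological_entropy_cvg] below. *)
Definition topological_entropy f : \bar R :=
  ereal_sup [set separated_growth f e | e in [set e | (0 < e)%R]].

Lemma separated_growth_le f e1 e2 :
  (e1 <= e2)%R -> separated_growth f e2 <= separated_growth f e1.
Proof.
move=> e12; rewrite /separated_growth /limn_esup /limf_esup.
apply: le_ereal_inf_tmp => _ [V oV <-].
apply: ge_ereal_inf.
exists (ereal_sup ((fun n => n%:R^-1%:E * lne (max_separated f n e2)) @` V)).
  by exists V.
apply: ge_ereal_sup => _ [n Vn <-].
apply: (@le_trans _ _ (n%:R^-1%:E * lne (max_separated f n e1))); last first.
  by apply: ereal_sup_ubound; exists n.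
have max_ge0 e : 0 <= max_separated f n e.
  apply: ereal_sup_ubound; exists fset0; last by rewrite cardfs0.
  by move=> x y; rewrite inE.
apply: lee_wpmul2l; first by rewrite lee_fin invr_ge0.
rewrite lee_lne ?in_itv/= ?max_ge0 ?leey//.
apply: ereal_sup_le => _ [A sA <-]; exists A => // x y xA yA xy.
by have [i ilt nb] := sA x y xA yA xy; exists i => // /(le_ball e12).
Qed.

Lemma topological_entropy_cvg f :
  separated_growth f e @[e --> 0%R^'+] --> topological_entropy f.
Proof.
have -> : topological_entropy f =
    ereal_sup [set separated_growth f e | e in `]0%R, +oo[].
  by congr ereal_sup; apply/seteqP; split=> _ [e e0 <-]; exists e => //;
    move: e0; rewrite /= in_itv/= ?andbT.
by apply: nonincreasing_at_right_cvge => // x y _ _; exact: separated_growth_le.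
Qed.

End TopologicalEntropy.

(* Main.v *)
Require Import Defs.
From mathcomp Require Import all_boot all_order all_algebra finmap.
From mathcomp Require Import ring lra zify.
From mathcomp Require Import all_classical all_reals all_analysis.

Set Implicit Arguments.
Unset Strict Implicit.
Unset Printing Implicit Defensive.

Import Order.TTheory GRing.Theory Num.Theory.
Import numFieldNormedType.Exports.

Local Open Scope classical_set_scope.
Local Open Scope ring_scope.

(** Every interval map with positive entropy has, for some iterate, a horseshoe:
two intervals each of which is mapped over both. A horseshoe produces a closed
invariant set that factors onto the full shift, so the point is to build a map in
which none of these factor maps can be a conjugacy.

The map is the tent map [T] in which every point of a countable dense set [D] is
blown up to a segment: the points of [0, 1] become pairs (base point, height),
where the height matters only over [D], and the new map is [T] on base points
and the identity or a flip on heights ([blowup]). The set [D] consists of the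
rationals of ]0, 1[ that are not dyadic. It is chosen so that [D x] and [D (T x)]
are equivalent, so that it misses the turning point 1/2, and so that it contains
every periodic point of [T] except 0 ([nondyadic_rational]). The blown-up map
keeps the shape of the tent map ([full_unimodal]), hence is continuous,
surjective and of positive entropy. Over a periodic point of [T] of period p the
p-th iterate is the identity or a flip, hence the 2p-th iterate is the identity:
every periodic point other than 0 lies in a nondegenerate segment of periodic
points of a common period ([periodic_segments]).

This last property excludes full shifts. Suppose that [e] embeds the Cantor space
in [0, 1] and carries the shift to [F^n]. A point whose orbit meets the turning
point ends at the fixed point 0, so its sequence is eventually constant, equal to
the symbol of 0. Away from such sequences, [F^n] is monotone on the convex hull of
the image of each small cylinder ([turn_avoided], [uniform_same_side_family]).
Take three periodic sequences in one small cylinder, in which two consecutive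
symbols are never both the symbol of 0 ([rare_word]). The middle one in the order
of the interval, [q], has points [z] and [z'] of the same cylinder on either side
of it; pulling these back along the periodic orbit of [q], by an even number of
periods so that the order is preserved, shows that the image of [e] accumulates
at [e q] from both sides ([pull_back]). One of these sides is filled by points of a
common period, so some sequence other than [q] agrees with [q] on a full period
and has that period, which is absurd ([no_shift_embedding]). *)

(** * Atomic masses and blow-ups of the line *)

Section AtomicMass.
Context {R : realType} (q : nat -> R).
Implicit Types P Q S : R -> bool.

Let w (i : nat) : R := geometric 2^-1 2^-1 i.

Let w_gt0 i : 0 < w i.
Proof. by rewrite /w /geometric /= mulr_gt0// exprn_gt0. Qed.

(** The mass of [P] for the probability measure with an atom of weight 2^-(i+1) at
each point [q i]; repetitions in [q] are harmless, their weights add up. *)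
Definition mass P : R := limn (series (fun i => (P (q i))%:R * w i)).

Let term_ge0 P i : 0 <= (P (q i))%:R * w i.
Proof. by rewrite mulr_ge0// ltW. Qed.

Let mass_cvg P : cvgn (series (fun i => (P (q i))%:R * w i)).
Proof.
apply: (@series_le_cvg _ _ w) => [i|i|i|].
- exact: term_ge0.
- exact: ltW.
- by case: (P _); rewrite ?mul1r// mul0r ltW.
- by apply: is_cvg_geometric_series; rewrite ger0_norm; lra.
Qed.

Lemma partial_le_mass P n : \sum_(0 <= i < n) (P (q i))%:R * w i <= mass P.
Proof.
apply: (@nondecreasing_cvgn_le _ (series (fun i => (P (q i))%:R * w i))) => //.
by apply: nondecreasing_series => i _ _; exact: term_ge0.
Qed.

Lemma mass_le P y :
  (forall n, \sum_(0 <= i < n) (P (q i))%:R * w i <= y) -> mass P <= y.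
Proof. by move=> H; apply: limr_le => //; apply: nearW => n; exact: H. Qed.

Lemma massD P Q S : (forall x, (P x + Q x = S x)%N) -> mass P + mass Q = mass S.
Proof.
move=> PQS; rewrite /mass -limD// -seriesD.
congr (limn (series _)); apply/funext => i /=.
by rewrite -[LHS]/(_ * _ + _ * _) -mulrDl -natrD PQS.
Qed.

Lemma massT : mass xpredT = 1.
Proof.
rewrite /mass (_ : (fun i => _) = geometric 2^-1 2^-1); last first.
  by apply/funext => i; rewrite /= mul1r.
have half_lt1 : `|2^-1 : R| < 1 by rewrite ger0_norm; lra.
by rewrite (cvg_lim _ (@cvg_geometric_series _ _ _ half_lt1))//; field.
Qed.

Lemma mass_predC P Q : (forall x, Q x = ~~ P x) -> mass P + mass Q = 1.
Proof. by move=> QP; rewrite -massT; apply: massD => x; rewrite QP; case: (P x). Qed.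

Lemma mass_ge0 P : 0 <= mass P.
Proof. by have := partial_le_mass P 0; rewrite big_geq. Qed.

Lemma mass_gt0 P i : P (q i) -> 0 < mass P.
Proof.
move=> Pi; apply: lt_le_trans (partial_le_mass P i.+1).
by rewrite big_nat_recr//= Pi mul1r ltr_wpDl// sumr_ge0.
Qed.

Lemma mass_eq0 P : (forall i, ~~ P (q i)) -> mass P = 0.
Proof.
move=> P0; apply/eqP; rewrite eq_le mass_ge0 andbT; apply: mass_le => n.
by rewrite big1// => i _; rewrite (negbTE (P0 _)) mul0r.
Qed.

End AtomicMass.

(** Blowing up the points of [D] amounts to spreading [0, 1] over the distribution
function of an atomic probability measure whose atoms are the points of [D]: the
fibre over [x] is [[A x, B x]], where [A] and [B] are the left and right limits of
the distribution function at [x]. Density of [D] makes distinct fibres disjoint;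
the fibres cover [0, 1] because [A] is left-continuous and [B] right-continuous. *)
Lemma blowup_coordinates (R : realType) (D : set R) :
  countable D ->
  (forall x, D x -> 0 < x < 1) ->
  (forall x x', 0 <= x -> x < x' -> x' <= 1 -> exists2 d, D d & x < d < x') ->
  exists A B : R -> R, [/\ A 0 = 0 /\ B 1 = 1,
    forall x, A x <= B x, forall x, A x < B x <-> D x,
    forall x x', 0 <= x -> x < x' -> x' <= 1 -> B x < A x' &
    forall y, 0 <= y <= 1 -> exists2 x, 0 <= x <= 1 & A x <= y <= B x].
Proof.
move=> cD D01 denseD.
have [q qD] : exists q : nat -> R, range q = D.
  have /pfcard_geP [D0|[q]] : (D #<= [set: nat])%card by exact: cD.
    by have [d] := denseD 0 1 (lexx _) ltr01 (lexx _); rewrite D0.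
  by exists q; apply/seteqP; split => [_ [i _ <-]|d /(@surj _ _ _ _ q) [i]];
    [exact: funS|exists i].
have Dq i : D (q i) by rewrite -qD; exists i.
pose A x := mass q (fun d => d < x).
pose B x := mass q (fun d => d <= x).
have AB x : A x + mass q (fun d => d == x) = B x.
  by apply: massD => d; case: ltgtP.
have A0 : A 0 = 0 by apply: mass_eq0 => i; have := D01 _ (Dq i); lra.
have B1 : B 1 = 1.
  have := @mass_predC _ q (fun d => d <= 1) (fun d => 1 < d).
  move=> /(_ (fun x => ltNge _ _)); rewrite [X in _ + X]mass_eq0 ?addr0// => i.
  by have := D01 _ (Dq i); lra.
exists A, B; split => //.
- by move=> x; rewrite -AB lerDl mass_ge0.
- move=> x; rewrite -AB ltrDl; split => [|].
    apply: contraPP => nDx; rewrite mass_eq0 ?ltxx// => i.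
    by apply/eqP => qx; apply: nDx; rewrite -qx.
  by rewrite -qD => -[i _ qx]; apply: (@mass_gt0 _ _ _ i); rewrite qx.
- move=> x x' x0 xx' x1; have [d Dd /andP[xd dx']] := denseD _ _ x0 xx' x1.
  move: Dd; rewrite -qD => -[i _ qd].
  rewrite /A -(@massD _ q (fun d => d <= x) (fun d => x < d < x')).
    by rewrite ltrDl (@mass_gt0 _ _ _ i)// qd xd dx'.
  by move=> e; case: leP => xe //=; rewrite (le_lt_trans xe xx').
- move=> y /andP[y0 y1].
  pose S := [set x | 0 <= x <= 1 /\ A x <= y].
  have S0 : S 0 by split; rewrite ?lexx ?ler01// A0.
  have Sub : ubound S 1 by move=> x [/andP[]].
  have hS : has_sup S by split; [exists 0|exists 1].
  have s0 : 0 <= sup S by apply: ub_le_sup => //; exists 1.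
  have s1 : sup S <= 1 by apply: ge_sup => //; exists 0.
  exists (sup S); rewrite ?s0//; apply/andP; split.
  + (* left continuity of [A]: a partial sum sees finitely many atoms, and those
       below [sup S] are all below a single element of [S] *)
    apply: mass_le => n.
    have [x [x01 Axy] xn] : exists2 x, S x &
        forall i, (i < n)%N -> q i < sup S -> q i < x.
      elim: n => [|n [x Sx xn]]; first by exists 0.
      have [qn|qn] := ltP (q n) (sup S); last first.
        exists x => // i; rewrite ltnS leq_eqVlt => /predU1P[->|]; last exact: xn.
        by rewrite ltNge qn.
      have [x' Sx' qx'] := @sup_gt _ S _ (ex_intro _ _ S0) qn.
      have [xx'|x'x] := leP x x'.
        exists x' => // i; rewrite ltnS leq_eqVlt => /predU1P[->//|].
        by move=> /xn /[apply] /lt_le_trans; apply.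
      exists x => // i; rewrite ltnS leq_eqVlt => /predU1P[->_|]; last exact: xn.
      exact: lt_trans x'x.
    apply: le_trans Axy; apply: le_trans (partial_le_mass q _ n).
    rewrite !big_seq; apply: ler_sum => i; rewrite mem_index_iota => /andP[_ iltn].
    apply: ler_wpM2r; first by rewrite /geometric/= mulr_ge0// exprn_ge0.
    by have := xn _ iltn; case: ltP => // _ ->.
  + have {s1} : (sup S == 1) || (sup S < 1) by rewrite -le_eqVlt.
    move=> /predU1P[->|s1]; first by rewrite B1.
    have := @mass_predC _ q (fun d => d <= sup S) (fun d => sup S < d).
    move=> /(_ (fun x => ltNge _ _)) massC.
    (* right continuity of [B], read off on the complementary mass: a single point
       beyond [sup S] precedes finitely many atoms lying beyond [sup S] *)
    suff : mass q (fun d => sup S < d) <= 1 - y by move: massC; rewrite -/(B _); lra.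
    apply: mass_le => n.
    have [x /andP[sx x1] xn] : exists2 x, sup S < x <= 1 &
        forall i, (i < n)%N -> sup S < q i -> x <= q i.
      elim: n => [|n [x /andP[sx x1] xn]]; first by exists 1; rewrite // s1 lexx.
      have [qn|qn] := ltP (sup S) (q n); last first.
        exists x; rewrite ?sx// => i; rewrite ltnS leq_eqVlt => /predU1P[->|]; last exact: xn.
        by rewrite ltNge qn.
      exists (Num.min x (q n)); first by rewrite lt_min sx qn ge_min x1.
      move=> i; rewrite ltnS leq_eqVlt => /predU1P[->_|]; first by rewrite ge_min lexx orbT.
      by move=> /xn /[apply] h; rewrite ge_min h.
    have Ax : y < A x.
      rewrite ltNge; apply/negP => Axy.
      have : x <= sup S by apply: ub_le_sup; [exists 1|split => //; lra].
      by rewrite leNgt sx.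
    have := @mass_predC _ q (fun d => d < x) (fun d => x <= d).
    move=> /(_ (fun x => leNgt _ _)) massC'.
    apply: (@le_trans _ _ (mass q (fun d => x <= d))); last first.
      by move: massC'; rewrite -/(A _); lra.
    apply: le_trans (partial_le_mass q _ n).
    rewrite !big_seq; apply: ler_sum => i; rewrite mem_index_iota => /andP[_ iltn].
    apply: ler_wpM2r; first by rewrite /geometric/= mulr_ge0// exprn_ge0.
    by have := xn _ iltn; case: ltP => // _ ->.
Qed.

(** * Full unimodal maps *)

(** Continuity is not a field: it follows from monotonicity and surjectivity of the
two branches. *)
Record full_unimodal (R : realType) (F : R -> R) (c : R) : Prop := FullUnimodal {
  turn_itv : 0 < c < 1 ;
  unimodal0 : F 0 = 0 ;
  unimodal_turn : F c = 1 ;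
  unimodal1 : F 1 = 0 ;
  unimodal_inc : {in `[0, c] &, {homo F : x y / x < y}} ;
  unimodal_dec : {in `[c, 1] &, {homo F : x y /~ x < y}} ;
  unimodal_surjl : forall z, 0 <= z <= 1 -> exists2 y, 0 <= y <= c & F y = z ;
  unimodal_surjr : forall z, 0 <= z <= 1 -> exists2 y, c <= y <= 1 & F y = z
}.

(** The point 0 is excluded: it is fixed by every full unimodal map, and being an end
of [0, 1] it is never approached from both sides. *)
Definition periodic_segments (R : realType) (F : R -> R) : Prop :=
  forall p b, (0 < p)%N -> 0 < b <= 1 -> iter p F b = b ->
  exists u v, [/\ u < v, u <= b <= v &
    forall y, u <= y <= v -> iter (2 * p) F y = y].

Section Unimodal.
Context {R : realType} {F : R -> R} {c : R} (Fc : full_unimodal F c).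

Lemma unimodal_itv x : 0 <= x <= 1 -> 0 <= F x <= 1.
Proof.
have /andP[c0 c1] := turn_itv Fc => /andP[x0 x1].
have [xc|cx|->] := ltgtP x c; last by rewrite (unimodal_turn Fc) ler01 lexx.
- have -> /= : F x <= 1.
    rewrite -(unimodal_turn Fc) ltW// (unimodal_inc Fc)// in_itv/= ?x0 ?c0 ?lexx ltW//.
  move: x0; rewrite le_eqVlt => /predU1P[<-|x0]; first by rewrite (unimodal0 Fc) lexx.
  rewrite -[leLHS](unimodal0 Fc) andbT ltW// (unimodal_inc Fc)// in_itv/= ?lexx ?ltW//.
- have -> /= : F x <= 1.
    rewrite -(unimodal_turn Fc) ltW// (unimodal_dec Fc)// in_itv/= ?x1 ?lexx ltW//.
  move: x1; rewrite le_eqVlt => /predU1P[->|x1]; first by rewrite (unimodal1 Fc) lexx.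
  rewrite -[leLHS](unimodal1 Fc) andbT ltW// (unimodal_dec Fc)// in_itv/= ?lexx ?ltW//.
Qed.

End Unimodal.

(** * The blown-up tent map *)

Definition tent (R : realType) (x : R) : R := if x < 2^-1 then 2 * x else 2 - 2 * x.

Lemma tentl (R : realType) (x : R) : x <= 2^-1 -> tent x = 2 * x.
Proof. by rewrite /tent; case: ltP => //; lra. Qed.

Lemma tentr (R : realType) (x : R) : 2^-1 <= x -> tent x = 2 - 2 * x.
Proof. by rewrite /tent; case: ltP => //; lra. Qed.

(** The hypotheses on [A] and [B] are those delivered by [blowup_coordinates]; those
on [D] say that the blow-up is compatible with the tent map. *)
Section Blowup.
Context {R : realType} (D : set R) (A B : R -> R).
Implicit Types x y z r : R.
Hypothesis D01 : forall x : R, D x -> 0 < x < 1.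
Hypothesis nD_half : ~ D 2^-1.
Hypothesis D_tent : forall x : R, 0 <= x <= 1 -> D (tent x) <-> D x.
Hypothesis D_periodic : forall p (x : R),
  (0 < p)%N -> 0 < x <= 1 -> iter p (@tent R) x = x -> D x.
Hypothesis A0 : A 0 = 0.
Hypothesis B1 : B 1 = 1.
Hypothesis AB : forall x, A x <= B x.
Hypothesis ltAB : forall x, A x < B x <-> D x.
Hypothesis ltBA : forall x x' : R, 0 <= x -> x < x' -> x' <= 1 -> B x < A x'.
Hypothesis AB_cover : forall y : R, 0 <= y <= 1 -> exists2 x : R, 0 <= x <= 1 & A x <= y <= B x.

Lemma tent_itv (x : R) : 0 <= x <= 1 -> 0 <= tent x <= 1.
Proof. by rewrite /tent; case: ltP; lra. Qed.

Let eqAB x : ~ D x -> B x = A x.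
Proof. by rewrite -ltAB => /negP; rewrite -leNgt => BA; apply/le_anti; rewrite BA AB. Qed.

Let nD0 : ~ D 0. Proof. by move=> /D01; rewrite ltxx. Qed.
Let nD1 : ~ D 1. Proof. by move=> /D01; rewrite ltxx andbF. Qed.
Let A1 : A 1 = 1. Proof. by rewrite -(eqAB nD1). Qed.

(** [place] and ([fiber], [height]) translate between points of [0, 1] and pairs of a
base point [x] and a height in [0, 1]. Outside [D] fibres are single points: the
division by zero then gives height 0, and [place] ignores the height. *)
Definition fiber y := xget 0 [set x | 0 <= x <= 1 /\ A x <= y <= B x].
Definition place x r := A x + (B x - A x) * r.
Definition height y := (y - A (fiber y)) / (B (fiber y) - A (fiber y)).

Let fiberP y : 0 <= y <= 1 -> 0 <= fiber y <= 1 /\ A (fiber y) <= y <= B (fiber y).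
Proof. by move=> /AB_cover[x x01 xy]; rewrite /fiber; case: xgetP => [z -> //|/(_ x)[]]. Qed.

Let fiber_itv y : 0 <= y <= 1 -> 0 <= fiber y <= 1.
Proof. by case/fiberP. Qed.

Let fiber_uniq x y : 0 <= x <= 1 -> A x <= y <= B x -> fiber y = x.
Proof.
move=> x01 xy; have : [set x | 0 <= x <= 1 /\ A x <= y <= B x] x by [].
rewrite /fiber => /xgetI -/(_ 0) [z01 zy]; move: z01 zy.
set z := xget _ _ => z01 zy; have [zx|xz|//] := ltgtP z x.
- by have := @ltBA z x; lra.
- by have := @ltBA x z; lra.
Qed.

Let place_itv x r : 0 <= r <= 1 -> A x <= place x r <= B x.
Proof. by move=> r01; have := AB x; rewrite /place; nra. Qed.

Let nD_place x r : ~ D x -> place x r = A x.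
Proof. by move=> /eqAB xAB; rewrite /place xAB subrr mul0r addr0. Qed.

Let fiber_place x r : 0 <= x <= 1 -> 0 <= r <= 1 -> fiber (place x r) = x.
Proof. by move=> x01 r01; apply: fiber_uniq => //; exact: place_itv. Qed.

Let height_itv y : 0 <= y <= 1 -> 0 <= height y <= 1.
Proof.
move=> /fiberP[x01]; rewrite /height; have := AB (fiber y).
set x := fiber y; rewrite le_eqVlt => /predU1P[->|ABx]; first by rewrite subrr invr0 mulr0 lexx ler01.
move=> /andP[Ay yB]; apply/andP; split; first by rewrite divr_ge0 ?subr_ge0// ltW.
by rewrite ler_pdivrMr ?subr_gt0// mul1r; lra.
Qed.

Let place_height y : 0 <= y <= 1 -> place (fiber y) (height y) = y.
Proof.
move=> /fiberP[x01]; rewrite /height /place.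
set x := fiber y; have := AB x; rewrite le_eqVlt => /predU1P[ABx|ABx].
  by rewrite ABx subrr mul0r addr0 => /le_anti.
by move=> _; rewrite mulrCA mulfV ?mulr1 ?subr_eq0 ?gt_eqF//; lra.
Qed.

Let height_place x r : 0 <= x <= 1 -> 0 <= r <= 1 -> D x -> height (place x r) = r.
Proof.
move=> x01 r01 Dx; rewrite /height fiber_place// /place addrAC subrr add0r mulrAC.
by rewrite mulfV ?mul1r// subr_eq0 gt_eqF//; exact/ltAB.
Qed.

Let place_lt x x' r r' : 0 <= x <= 1 -> 0 <= x' <= 1 -> 0 <= r <= 1 -> 0 <= r' <= 1 ->
  x < x' -> place x r < place x' r'.
Proof.
move=> /andP[x0 _] /andP[_ x'1] /(@place_itv x) /andP[_ rB] /(@place_itv x')/andP[A'r' _] xx'.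
by apply: le_lt_trans rB _; apply: lt_le_trans A'r'; exact: ltBA.
Qed.

Let place_ltr x r r' : D x -> r < r' -> place x r < place x r'.
Proof. by move=> /ltAB ABx rr'; rewrite /place ltrD2l ltr_pM2l ?subr_gt0. Qed.

Let place01 x r : 0 <= x <= 1 -> 0 <= r <= 1 -> 0 <= place x r <= 1.
Proof.
move=> x01 r01; have /andP[] := x01; rewrite !le_eqVlt.
move=> /predU1P[<- _|x0 /predU1P[->|x1]]; first by rewrite nD_place// A0 ltr01 eqxx orbT.
  by rewrite nD_place// A1 ltr01 eqxx orbT.
apply/andP; split; apply/orP; right.
  by rewrite -[ltLHS]A0 -(nD_place 0 nD0) place_lt ?lexx ?ler01.
by rewrite -[ltRHS]A1 -(nD_place 0 nD1) place_lt ?lexx ?ler01.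
Qed.

(** The height is reversed over the decreasing branch of the tent map, which makes
the blown-up map decrease there as well. *)
Definition blowup y : R :=
  let x := fiber y in
  place (tent x) (if x < 2^-1 then height y else 1 - height y).

Let blowup_place x r : 0 <= x <= 1 -> 0 <= r <= 1 ->
  blowup (place x r) = place (tent x) (if x < 2^-1 then r else 1 - r).
Proof.
move=> x01 r01; rewrite /blowup fiber_place//.
have [Dx|nDx] := EM (D x); first by rewrite height_place.
by rewrite !nD_place// D_tent.
Qed.

Let flip_itv r (b : bool) : 0 <= r <= 1 -> 0 <= (if b then r else 1 - r) <= 1.
Proof. by case: b; lra. Qed.

Let fiber0 : fiber 0 = 0.
Proof. by apply: fiber_uniq; rewrite ?lexx ?ler01// (eqAB nD0) A0 lexx. Qed.

Let fiber1 : fiber 1 = 1.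
Proof. by apply: fiber_uniq; rewrite ?lexx ?ler01// B1 A1 lexx. Qed.

Let turn := A 2^-1.

Let fiber_turn : fiber turn = 2^-1.
Proof. by apply: fiber_uniq; [lra|rewrite (eqAB nD_half) lexx]. Qed.

Let half01 : 0 <= (2^-1 : R) <= 1. Proof. lra. Qed.

Let turn_itv : 0 < turn < 1.
Proof.
apply/andP; split.
  by rewrite -[ltLHS]A0 -(eqAB nD0) ltBA//; case/andP: half01.
by rewrite /turn -(eqAB nD_half) -[ltRHS]A1 ltBA//; lra.
Qed.

Let fiber_le y y' : 0 <= y <= 1 -> 0 <= y' <= 1 -> y <= y' -> fiber y <= fiber y'.
Proof.
move=> y01 y'01; apply: contraTT; rewrite -!ltNge.
move=> ff; rewrite -(place_height y01) -(place_height y'01).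
by apply: place_lt; rewrite ?fiber_itv ?height_itv.
Qed.

Let lt_fiber y y' : 0 <= y <= 1 -> 0 <= y' <= 1 -> y < y' ->
  fiber y < fiber y' \/ [/\ fiber y' = fiber y, D (fiber y) & height y < height y'].
Proof.
move=> y01 y'01 yy'; have := fiber_le y01 y'01 (ltW yy').
rewrite le_eqVlt => /predU1P[ff|]; [right|by left].
move: yy'; rewrite -{1}(place_height y01) -{1}(place_height y'01) -ff.
have [Dy|nDy] := EM (D (fiber y)); last by rewrite !nD_place// ltxx.
rewrite /place ltrD2l ltr_pM2l ?subr_gt0; last exact/ltAB.
by [].
Qed.

(** The order of [0, 1] is the lexicographic order on pairs (base point, height), on
which both branches are visibly monotone; the turning point is the fibre over
1/2, a single point since 1/2 is not in [D]. *)
Lemma blowup_unimodal : full_unimodal blowup turn.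
Proof.
have half_lt1 : (2^-1 : R) < 1 by lra.
have [turn0 turn1] := andP turn_itv.
split => //.
- have half_gt0 : 0 < (2^-1 : R) by lra.
  by rewrite /blowup fiber0 /tent half_gt0 mulr0 nD_place.
- rewrite /blowup fiber_turn /tent ltxx (_ : 2 - _ = 1 :> R); last by field.
  by rewrite nD_place.
- rewrite /blowup fiber1 /tent ifF; last by apply/negbTE; lra.
  by rewrite mulr1 subrr nD_place.
- move=> y y'; rewrite !in_itv/= => /andP[y0 yt] /andP[y'0 y't] yy'.
  have y01 : 0 <= y <= 1 by lra.
  have y'01 : 0 <= y' <= 1 by lra.
  have t01 : 0 <= turn <= 1 by lra.
  have fy' : fiber y' <= 2^-1 by rewrite -fiber_turn fiber_le.
  have f0 := fiber_itv y01.
  rewrite /blowup; have [ff|[ff Dy rr]] := lt_fiber y01 y'01 yy'.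
    apply: place_lt; rewrite ?tent_itv ?fiber_itv ?flip_itv ?height_itv//.
    by rewrite !tentl; lra.
  have fh : fiber y < 2^-1.
    rewrite lt_neqAle -{2}ff fy' andbT.
    by apply: contra_not_neq nD_half => <-.
  by rewrite ff fh; apply: place_ltr => //; apply/D_tent.
- move=> y y'; rewrite !in_itv/= => /andP[ty y1] /andP[ty' y'1] yy'.
  have y01 : 0 <= y <= 1 by lra.
  have y'01 : 0 <= y' <= 1 by lra.
  have t01 : 0 <= turn <= 1 by lra.
  have fy : 2^-1 <= fiber y by rewrite -fiber_turn fiber_le.
  have fy' : 2^-1 <= fiber y' by rewrite -fiber_turn fiber_le.
  have f0 := fiber_itv y01.
  rewrite /blowup; have [ff|[-> Dy rr]] := lt_fiber y'01 y01 yy'.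
    apply: place_lt; rewrite ?tent_itv ?fiber_itv ?flip_itv ?height_itv//.
    by rewrite !tentr; lra.
  rewrite [fiber y' < _]ltNge fy' /=; apply: place_ltr; last by lra.
  by apply/D_tent; rewrite ?fiber_itv.
- move=> z z01; have := fiber_itv z01; have := height_itv z01 => r01 x01.
  have x2 : 0 <= fiber z / 2 <= 1 by lra.
  exists (place (fiber z / 2) (height z)).
    have := place01 x2 r01 => /andP[-> _] /=.
    rewrite /turn -(nD_place 0 nD_half).
    have [->|x1] := eqVneq (fiber z) 1; first by rewrite !div1r !nD_place.
    by rewrite ltW// place_lt// ?lexx ?ler01//; lra.
  rewrite blowup_place//; have [z1|x1] := eqVneq (fiber z) 1.
    rewrite z1 /tent div1r ltxx (_ : 2 - _ = 1 :> R); last by field.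
    rewrite nD_place// A1 -[RHS](place_height z01) z1 nD_place//.
  have h : fiber z / 2 < 2^-1 by lra.
  by rewrite h /tent h mulrC divfK// place_height.
- move=> z z01; have := fiber_itv z01; have := height_itv z01 => r01 x01.
  have x2 : 0 <= 1 - fiber z / 2 <= 1 by lra.
  have r01' : 0 <= 1 - height z <= 1 by lra.
  exists (place (1 - fiber z / 2) (1 - height z)).
    have := place01 x2 r01' => /andP[_ ->]; rewrite andbT.
    rewrite /turn -(nD_place 0 nD_half).
    have [->|x1] := eqVneq (fiber z) 1.
      by rewrite div1r (_ : 1 - 2^-1 = 2^-1 :> R) ?nD_place//; field.
    by rewrite ltW// place_lt// ?lexx ?ler01//; lra.
  rewrite blowup_place// ifF; last by apply/negbTE; lra.
  rewrite /tent ifF; last by apply/negbTE; lra.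
  rewrite subKr (_ : 2 - _ = fiber z) ?place_height//; by field.
Qed.

Let iter_tent_itv n x : 0 <= x <= 1 -> 0 <= iter n (@tent R) x <= 1.
Proof. by move=> x01; elim: n => //= n; exact: tent_itv. Qed.

(** The choice between height and reversed height depends on the base point alone,
so an iterate acts on a whole fibre as one affine map. *)
Let iter_blowup_place n x : 0 <= x <= 1 -> exists b : bool,
  forall r, 0 <= r <= 1 ->
  iter n blowup (place x r) = place (iter n (@tent R) x) (if b then r else 1 - r).
Proof.
move=> x01; elim: n => [|n [b IH]]; first by exists true.
exists (b (+) ~~ (iter n (@tent R) x < 2^-1)) => r r01.
rewrite /= IH// blowup_place ?iter_tent_itv ?flip_itv//.
by case: (_ < _); case: b {IH} => //=; rewrite subKr.
Qed.

(** The segment is the fibre containing the periodic point. Its base point is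
periodic for the tent map, so the fibre is nondegenerate, and the return map of
the fibre is the identity or the flip, whose square is the identity. *)
Lemma blowup_periodic : periodic_segments blowup.
Proof.
move=> p y p0 /andP[y0 y1] py.
have y01 : 0 <= y <= 1 by rewrite ltW.
set x := fiber y; have x01 : 0 <= x <= 1 by exact: fiber_itv.
have [b bP] := iter_blowup_place p x01.
have px : iter p (@tent R) x = x.
  have := bP _ (height_itv y01); rewrite place_height// py => /(congr1 fiber).
  by rewrite fiber_place ?iter_tent_itv ?flip_itv ?height_itv// => <-.
have Dx : D x.
  apply: (@D_periodic p) => //; case/andP: x01 => + ->; rewrite andbT le_eqVlt => /predU1P[x0|//].
  have := place_height y01; rewrite -/x -x0 nD_place// A0 => y0'.
  by rewrite y0' ltxx in y0.
have [_ xy] := fiberP y01.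
exists (A x), (B x); split => //; first exact/ltAB.
move=> z zx; have zf : fiber z = x by exact: fiber_uniq.
have z01 : 0 <= z <= 1.
  have := place01 x01 (r := 0); have := place01 x01 (r := 1); rewrite /place; lra.
have r01 := height_itv z01; have := place_height z01; rewrite zf => zE; rewrite -{1}zE -[RHS]zE.
rewrite mul2n -addnn iterD bP// px bP ?flip_itv// px.
by case: (b); rewrite ?subKr.
Qed.

End Blowup.

(** * The non-dyadic rationals *)

Section NonDyadic.
Context {R : realType}.
Implicit Types x y : R.

(** Non-dyadic means that no [2 ^+ l * x] is an integer, which is exactly what keeps
the tent orbit of [x] away from 0 and 1, hence away from 1/2. *)
Definition nondyadic_rational : set R := [set x | [/\ 0 < x < 1,
  range (@ratr R) x & forall l, 2 ^+ l * x \isn't a Num.int]].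

Let D := nondyadic_rational.

Let countable_D : countable D.
Proof.
apply: (@sub_countable _ _ D (range (@ratr R))); last first.
  exact: (card_le_trans (card_image_le _ _) (countableP _)).
by apply: subset_card_le => x [].
Qed.

Let dense_D x x' : 0 <= x -> x < x' -> x' <= 1 -> exists2 d, D d & x < d < x'.
Proof.
move=> x0 xx' x'1; pose k := Num.bound (2 / (x' - x)).
have k2 : 2 < (x' - x) * 2 ^+ k.
  rewrite mulrC -ltr_pdivrMr ?subr_gt0//.
  apply: lt_trans (archi_boundP _) _; first by rewrite divr_ge0// subr_ge0 ltW.
  by rewrite -natrX ltr_nat ltn_expl.
have k0 : 0 < 2 ^+ k :> R by rewrite exprn_gt0.
(* the points (j + 4/3) / 2^k, with denominator divisible by 3, are non-dyadic and
   are spaced by less than (x' - x) / 2 *)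
pose j := Num.floor (2 ^+ k * x).
have jx : j%:~R <= 2 ^+ k * x < j%:~R + 1 by rewrite -(intrD _ _ 1) floor_itv.
pose d : R := (3 * j%:~R + 4) / (3 * 2 ^+ k).
have dk : d * 2 ^+ k = j%:~R + 4 / 3 by rewrite /d; field; rewrite gt_eqF.
have xd : x < d by rewrite -(ltr_pM2r k0) dk; lra.
have dx' : d < x' by rewrite -(ltr_pM2r k0) dk; lra.
exists d; last by rewrite xd.
split; first by lra.
- exists ((3 * j%:~R + 4) / (3 * 2 ^+ k)) => //.
  by rewrite fmorph_div rmorphD !rmorphM /= rmorphXn/= !ratr_nat ratr_int.
- move=> l; apply/negP => /intrP[i li].
  have : 2 ^+ l * (3 * j + 4) = 3 * (2 ^+ k * i) :> int.
    apply: (@intr_inj R); rewrite !rmorphM rmorphD !rmorphM /= !rmorphXn/= -li.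
    by rewrite /d; field; rewrite gt_eqF.
  move=> /(congr1 (fun z => (3 %| z)%Z)); rewrite [RHS]dvdz_mulr//.
  rewrite Gauss_dvdzr; last first.
    by rewrite coprimezXr.
  by move=> /dvdzP[m]; lia.
Qed.

Let nD_half : ~ D 2^-1.
Proof. by move=> [_ _ /(_ 1%N)]; rewrite expr1 mulfV ?rpred1// pnatr_eq0. Qed.

Lemma tent_affine x : exists (a : int) (s : bool), tent x = a%:~R + (-1) ^+ s * 2 * x.
Proof.
rewrite /tent; case: ifP => _; [exists 0, false|exists 2, true].
  by rewrite add0r expr0 mul1r.
by rewrite expr1 mulN1r mulNr.
Qed.

Lemma iter_tent_affine n x : exists (a : int) (s : bool),
  iter n (@tent R) x = a%:~R + (-1) ^+ s * 2 ^+ n * x.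
Proof.
elim: n => [|n [a [s IH]]]; first by exists 0, false; rewrite add0r !expr0 !mul1r.
have [a' [s' /= ->]] := tent_affine (iter n (@tent R) x).
exists (a' + (-1) ^+ s' * 2 * a), (s (+) s').
rewrite IH rmorphD !rmorphM /= rmorphXn rmorphN1 signr_addb exprS /=.
by ring.
Qed.

Lemma tent_int l x : (2 ^+ l * tent x \is a Num.int) = (2 ^+ l.+1 * x \is a Num.int).
Proof.
have [a [s ->]] := tent_affine x.
rewrite mulrDr rpredDl; last by rewrite rpredM ?rpredX ?intr_int ?natr_int.
by rewrite -mulrA mulrCA rpredMsign exprSr mulrA.
Qed.

Lemma tent_rational x : range (@ratr R) (tent x) <-> range (@ratr R) x.
Proof.
have [a [s ->]] := tent_affine x; split => -[q _ qx].
  exists ((q - a%:~R) / ((-1) ^+ s * 2)) => //.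
  rewrite fmorph_div rmorphB rmorphM /= rmorph_sign ratr_nat ratr_int qx.
  by rewrite addrC addKr mulrAC divff ?mul1r// mulf_neq0 ?signr_eq0.
exists (a%:~R + (-1) ^+ s * 2 * q) => //.
by rewrite rmorphD !rmorphM /= rmorph_sign ratr_nat ratr_int qx.
Qed.

Let D_tent x : 0 <= x <= 1 -> D (tent x) <-> D x.
Proof.
move=> x01; split => -[t01 /tent_rational qx nx].
  split => // [|l]; last first.
    apply/negP => xl; have := nx l; rewrite tent_int exprS -mulrA => /negP; apply.
    by rewrite rpredM ?natr_int.
  have [x0|x0] := eqVneq x 0; first by move: t01; rewrite x0 tentl; lra.
  have [x1|x1] := eqVneq x 1; first by move: t01; rewrite x1 tentr; lra.
  by rewrite !lt_neqAle eq_sym x0 x1.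
split => // [|l]; last by rewrite tent_int.
have : x != 2^-1.
  by apply: contraNneq (nx 1%N) => ->; rewrite expr1 mulfV ?rpred1// pnatr_eq0.
by rewrite neq_lt => /orP[] xh; [rewrite tentl|rewrite tentr]; lra.
Qed.

(** A periodic point solves an affine equation with integer coefficients and slope
+-2^p different from 1, so it is rational. If it were dyadic, its orbit would
reach an integer, hence the fixed point 0, and could not return. *)
Let D_periodic p x : (0 < p)%N -> 0 < x <= 1 -> iter p (@tent R) x = x -> D x.
Proof.
move=> p0 x01 px.
have tent0 n : iter n (@tent R) 0 = 0.
  by elim: n => //= n ->; rewrite tentl; lra.
have pj j : iter (j * p) (@tent R) x = x by elim: j => // j IH; rewrite mulSn iterD IH.
have nx l : 2 ^+ l * x \isn't a Num.int.
  apply/negP => xl.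
  have : iter l.+1 (@tent R) x = 0.
    have t01 : 0 <= iter l (@tent R) x <= 1.
      elim: l {xl} => [|l IH]; first by rewrite /=; lra.
      exact: tent_itv.
    have : iter l (@tent R) x \is a Num.int.
      have [a [s ->]] := iter_tent_affine l x.
      by rewrite rpredD ?intr_int// -mulrA rpredMsign.
    move=> /intrP[i ix]; rewrite iterS; move: t01; rewrite ix.
    rewrite (ler_int _ 0) (ler_int _ i 1) => i01.
    have : i = 0 \/ i = 1 by lia.
    by case=> ->; [rewrite tentl; lra|rewrite tentr; lra].
  move=> xl0; have := pj l.+1; rewrite -(subnK (leq_pmulr l.+1 p0)) iterD xl0 tent0.
  lra.
split => //.
  have := nx 0; rewrite expr0 mul1r => xint.
  have : x != 1 by apply: contraNneq xint => ->.
  by move=> x1; rewrite [x < 1]lt_neqAle x1.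
have [a [s]] := iter_tent_affine p x; rewrite px => xE.
exists (a%:~R / (1 - (-1) ^+ s * 2 ^+ p)) => //.
have p1 : (1 : R) < 2 ^+ p by rewrite exprn_egt1// ?ltr1n//; lia.
have dn0 : 1 - (-1) ^+ s * 2 ^+ p != 0 :> R.
  by case: (s); rewrite ?expr0 ?expr1; lra.
rewrite fmorph_div rmorphB rmorphM /= rmorph_sign rmorphXn/= rmorph1 ratr_nat ratr_int.
by apply: (canLR (mulfK dn0)); rewrite [in RHS]mulrBr mulr1 {1}xE; ring.
Qed.

Theorem exists_unimodal_periodic_segments :
  exists (F : R -> R) c, full_unimodal F c /\ periodic_segments F.
Proof.
have D01 x : D x -> 0 < x < 1 by case.
have [A [B [[A0 B1] AB ltAB ltBA cover]]] := blowup_coordinates countable_D D01 dense_D.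
exists (blowup A B), (A 2^-1); split.
  exact: (blowup_unimodal D01 nD_half D_tent).
exact: (blowup_periodic D01 D_tent D_periodic).
Qed.

End NonDyadic.

(** * Entropy of horseshoes *)

Section HorseshoeEntropy.
Context {R : realType} {T : pseudoMetricType R} (f : T -> T).
Context (k : nat) (k_gt0 : (0 < k)%N) (h0 h1 : T -> T) (x0 : T) (e : R).
Hypothesis h0K : cancel h0 (iter k f).
Hypothesis h1K : cancel h1 (iter k f).
Hypothesis e_gt0 : 0 < e.
Hypothesis h01_apart : forall x y, ~ ball (h0 x) e (h1 y).

(** The images under the words of length [j] in [h0] and [h1] of a single point: two
of them are told apart at the first letter where the words differ. *)
Let separated_pow j : exists2 A : {fset T},
  #|` A| = (2 ^ j)%N & orbit_separated f (k * j) e A.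
Proof.
elim: j => [|j [A cardA sepA]].
  exists [fset x0]%fset; first by rewrite cardfs1.
  by move=> x y; rewrite !inE => /eqP-> /eqP->; rewrite eqxx.
exists ((h0 @` A) `|` (h1 @` A))%fset.
  rewrite cardfsU (_ : (_ `&` _ = fset0)%fset).
    by rewrite cardfs0 subn0 !card_imfset /= ?cardA ?expnS ?mul2n ?addnn//;
      apply: can_inj; eassumption.
  apply/fsetP => x; rewrite !inE; apply/negP => /andP[/imfsetP[y _ ->]].
  by move=> /imfsetP[z _ yz]; apply: (@h01_apart y z); rewrite -yz; exact: ballxx.
have apart10 x y : ~ ball (h1 x) e (h0 y) by move=> /ball_sym/h01_apart.
have lift h x y : cancel h (iter k f) -> x \in A -> y \in A -> h x != h y ->
    exists2 i, (i < k * j.+1)%N & ~ ball (iter i f (h x)) e (iter i f (h y)).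
  move=> hK xA yA hxy; have xy : x != y by apply: contra_neq hxy => ->.
  have [i ij nb] := sepA _ _ xA yA xy.
  exists (i + k)%N; first by rewrite mulnS addnC ltn_add2l.
  by rewrite !iterD !hK.
move=> x y; rewrite !inE => /orP[] /imfsetP[x' /= x'A ->] /orP[] /imfsetP[y' /= y'A ->] xy.
- exact: lift.
- by exists 0%N => //=; rewrite muln_gt0 k_gt0.
- by exists 0%N => //=; rewrite muln_gt0 k_gt0.
- exact: lift.
Qed.

Let max_separated_ge n : ((2 ^ (n %/ k))%:R%:E <= max_separated f n e)%E.
Proof.
have [A <- sepA] := separated_pow (n %/ k).
apply: ereal_sup_ubound; exists A => // x y xA yA xy.
have [i ilt nb] := sepA x y xA yA xy; exists i => //.
by apply: leq_trans ilt _; rewrite mulnC leq_trunc_div.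
Qed.

(** Orbits of length [n] hold 2^(n / k) separated points; as the integer part
of n / k is at least n / (2k) for [n >= k], the entropy is at least ln 2 / (2k). *)
Lemma horseshoe_entropy : (0 < topological_entropy f)%E.
Proof.
pose l : R := ln 2 / (2 * k)%:R.
have l0 : 0 < l.
  by rewrite divr_gt0 ?ltr0n ?muln_gt0//; apply: ln_gt0; rewrite ltr1n.
apply: (@lt_le_trans _ _ l%:E); first by rewrite lte_fin.
apply: (@le_trans _ _ (separated_growth f e)); last first.
  by apply: ereal_sup_ubound; exists e.
have growth n : (k <= n)%N ->
    (l%:E <= n%:R^-1%:E * lne (max_separated f n e))%E.
  move=> kn; have n0 : (0 < n)%N by exact: leq_trans kn.
  apply: (@le_trans _ _ (n%:R^-1%:E * lne (2 ^ (n %/ k))%:R%:E)%E); last first.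
    apply: lee_wpmul2l; first by rewrite lee_fin invr_ge0.
    rewrite lee_lne ?max_separated_ge// ?in_itv/= ?lee_fin ?ler0n ?leey//.
    by rewrite (le_trans _ (max_separated_ge n)) ?lee_fin ?leey.
  rewrite lne_EFin ?ltr0n ?expn_gt0// -EFinM lee_fin natrX lnXn//.
  rewrite /l mulrC -[ln 2 *+ _]mulr_natl mulrA ler_wpM2r//; first by rewrite ltW// ln_gt0// ltr1n.
  rewrite ler_pdivlMl ?ltr0n// mulrC ler_pdivrMl ?ltr0n ?muln_gt0//.
  rewrite -natrM ler_nat.
  have := divn_eq n k; have := ltn_pmod n k_gt0.
  have : (0 < n %/ k)%N by rewrite divn_gt0.
  nia.
apply: le_ereal_inf_tmp => _ [V [N _ NV] <-].
apply: (le_trans (growth (maxn k N) (leq_maxl _ _))).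
by apply: ereal_sup_ubound; exists (maxn k N) => //; apply: NV; exact: leq_maxr.
Qed.

End HorseshoeEntropy.

(** * Cylinders of the Cantor space *)

Definition agree (m : nat) (x y : nat -> bool) := forall k, (k < m)%N -> x k = y k.

Lemma iter_full_shift l (x : cantor_space) : iter l full_shift x = (fun k => x (l + k)%N).
Proof.
elim: l => [|l IH] /=; first by apply/funext.
by rewrite IH; apply/funext => k; rewrite /full_shift addnS addSn.
Qed.

Lemma nbhs_agree m (x : cantor_space) : \forall y \near x, agree m x y.
Proof.
elim: m => [|m IH]; first by apply: (@filterE _ (nbhs x)) => y k; rewrite ltn0.
have : \forall y \near x, y m = x m.
  have xm : nbhs (x m) [set x m] by exact: discrete_set1.
  exact: (@proj_continuous nat (fun=> bool) m x [set x m] xm).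
move=> xm; apply: (@filterS2 _ (nbhs x) _ _ _ _ _ IH xm) => y xy ym k.
by rewrite ltnS leq_eqVlt => /predU1P[->//|]; exact: xy.
Qed.

(** Compactness: every [y] other than [x] has a neighbourhood that the long cylinders
around [x] avoid, and finitely many such neighbourhoods cover the complement
of [U]. *)
Lemma agree_basis (x : cantor_space) (U : set cantor_space) :
  nbhs x U -> exists m, forall y, agree m x y -> U y.
Proof.
move=> xU.
have [m _ Um] : \forall m \near \oo, [set: cantor_space] `<=`
    (fun y => agree m x y -> U y).
  move: cantor_space_compact => /compact_near_coveringP.
  apply => y _.
  have [->|yx] := EM (y = x).
    by exists (U, setT); [split => //; exact: filterT|case=> y' m [Uy' _] _].
  have [k xk] : exists k, x k <> y k.
    apply: contrapT => /forallNP xy; apply: yx; apply/funext => k.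
    by have := contrapT (xy k).
  exists (agree k.+1 y, [set m | (k < m)%N]).
    by split; [exact: nbhs_agree|exists k.+1].
  by case=> y' m [/= yy' km] xy'; case: xk; rewrite xy'// yy'.
by exists m => y; apply: (Um m (leqnn m)).
Qed.

(** * Monotonicity along orbits that stay on the same side of the turning point *)

Definition same_side (R : realType) (c a b : R) : Prop :=
  (a < c /\ b < c) \/ (c < a /\ c < b).

(** The parity of the number of visits of [b] to the decreasing branch during [n]
steps: it tells whether the n-th iterate preserves or reverses the order near
[b]. *)
Fixpoint flips (R : realType) (F : R -> R) (c : R) n b :=
  if n is n'.+1 then (c < b) (+) flips F c n' (F b) else false.

Section SameSide.
Context {R : realType} {F : R -> R} {c : R} (Fc : full_unimodal F c).

Lemma flipsD n m b : flips F c (n + m) b = flips F c n b (+) flips F c m (iter n F b).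
Proof.
by elim: n b => [|n IH] b //=; rewrite IH -iterS iterSr addbA.
Qed.

(** An even number of periods contains an even number of order reversals. *)
Lemma flips_periodic p j b : iter p F b = b -> flips F c (p * (2 * j)) b = false.
Proof.
move=> pb; have pj i : iter (p * i) F b = b.
  by elim: i => [|i IH]; rewrite ?muln0// mulnS iterD IH.
elim: j => [|j IH]; first by rewrite !muln0.
by rewrite mulnS mulnDr flipsD pj IH addbF muln2 -addnn flipsD pb addbb.
Qed.

Lemma same_side_order n a b : 0 <= a <= 1 -> 0 <= b <= 1 ->
  (forall t, (t < n)%N -> same_side c (iter t F a) (iter t F b)) ->
  a != b -> iter n F a != iter n F b /\
  (a < b) = flips F c n b (+) (iter n F a < iter n F b).
Proof.
elim: n a b => [|n IH] a b //= a01 b01 sab ab.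
have step : F a != F b /\ (a < b) = (c < b) (+) (F a < F b).
  have [[ac bc]|[ca cb]] := sab 0 isT.
    have ai : a \in `[0, c] by rewrite in_itv/= (ltW ac); case/andP: a01 => ->.
    have bi : b \in `[0, c] by rewrite in_itv/= (ltW bc); case/andP: b01 => ->.
    rewrite (lt_gtF bc) addFb; case: (ltgtP a b) ab => // ab _.
      by have := unimodal_inc Fc ai bi ab; case: ltgtP.
    by have := unimodal_inc Fc bi ai ab; case: ltgtP.
  have ai : a \in `[c, 1] by rewrite in_itv/= (ltW ca); case/andP: a01 => _ ->.
  have bi : b \in `[c, 1] by rewrite in_itv/= (ltW cb); case/andP: b01 => _ ->.
  rewrite cb addTb; case: (ltgtP a b) ab => // ab _.
    by have := unimodal_dec Fc bi ai ab; case: ltgtP.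
  by have := unimodal_dec Fc ai bi ab; case: ltgtP.
have [Fab ->] := step.
have [||t tn||Fn ->] := IH (F a) (F b) => //.
- exact: unimodal_itv Fc _ _.
- exact: unimodal_itv Fc _ _.
- by have := sab t.+1 tn; rewrite !iterSr.
by rewrite -iterS iterSr -iterS iterSr addbA.
Qed.

End SameSide.

(** * Uniformity over cylinders *)

Lemma agree_sym m x y : agree m x y -> agree m y x.
Proof. by move=> xy k /xy. Qed.

Lemma agree_trans m x y z : agree m x y -> agree m y z -> agree m x z.
Proof. by move=> xy yz k km; rewrite xy ?yz. Qed.

Lemma agreeW m n x y : (m <= n)%N -> agree n x y -> agree m x y.
Proof. by move=> mn xy k km; rewrite xy ?(leq_trans km). Qed.

(** Compactness of the Cantor space makes [m] independent of [x]; membership in [K]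
being locally constant, a point outside [K] has a neighbourhood outside [K]. *)
Lemma uniform_same_side (R : realType) (c : R) (K : set cantor_space) k
    (g : cantor_space -> R) : continuous g ->
  (forall x y, agree k x y -> K x -> K y) -> (forall x, K x -> g x != c) ->
  exists m, forall x y, K x -> agree m x y -> same_side c (g x) (g y).
Proof.
move=> gc Kk gK.
have [m _ Um] : \forall m \near \oo, [set: cantor_space] `<=`
    (fun x => K x -> forall y, agree m x y -> same_side c (g x) (g y)).
  move: cantor_space_compact => /compact_near_coveringP.
  apply => x _.
  have [Kx|nKx] := EM (K x); last first.
    exists (agree k x, setT); first by split; [exact: nbhs_agree|exact: filterT].
    by case=> x' m [/= /agree_sym xx' _] /(Kk _ _ xx').
  have [U xU Uside] : exists2 U : set cantor_space, nbhs x U &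
      forall y z, U y -> U z -> same_side c (g y) (g z).
    have [gxc|cgx|/eqP] := ltgtP (g x) c; last by rewrite (negbTE (gK _ Kx)).
      exists [set y | g y < c]; last by move=> y z yc zc; left.
      exact: (cvgr_lt _ (gc x) _ gxc).
    exists [set y | c < g y]; last by move=> y z yc zc; right.
    exact: (cvgr_gt _ (gc x) _ cgx).
  have [m0 m0U] := agree_basis xU.
  exists (agree m0 x, [set m | (m0 <= m)%N]).
    by split; [exact: nbhs_agree|exists m0].
  case=> x' m [/= xx' m0m] _ y x'y; apply: Uside; first exact: m0U.
  by apply: m0U; apply: agree_trans xx' _; apply: agreeW x'y.
by exists m => x y Kx xy; exact: (Um m (leqnn m) x I Kx y xy).
Qed.

Lemma uniform_same_side_family (R : realType) (c : R) (K : set cantor_space) k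
    (g : nat -> cantor_space -> R) n : (forall i, continuous (g i)) ->
  (forall x y, agree k x y -> K x -> K y) ->
  (forall i x, (i < n)%N -> K x -> g i x != c) ->
  exists m, forall i x y, (i < n)%N -> K x -> agree m x y ->
    same_side c (g i x) (g i y).
Proof.
move=> gc Kk; elim: n => [|n IH] gK; first by exists 0%N.
have [m mP] : exists m, forall i x y, (i < n)%N -> K x -> agree m x y ->
    same_side c (g i x) (g i y).
  by apply: IH => i x ltin; apply: gK; rewrite ltnS ltnW.
have [m' m'P] := uniform_same_side (gc n) Kk (fun x => gK n x (ltnSn n)).
exists (maxn m m') => i x y; rewrite ltnS leq_eqVlt => /predU1P[->|ltin] Kx xy.
  by apply: m'P => //; apply: agreeW xy; rewrite leq_maxr.
by apply: mP => //; apply: agreeW xy; rewrite leq_maxl.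
Qed.

(** * Periodic sequences in which one symbol is rare *)

(** The periodic sequence with period word [s^u (~~ s)]. For large [u] these words
share a long prefix of [s], so they lie in a common cylinder, and they never show
two consecutive symbols [~~ s]. *)
Definition rare_word (s : bool) u : cantor_space :=
  fun i => if (i %% u.+1)%N == u then ~~ s else s.

Lemma rare_word_agree s m u v : (m <= u)%N -> (m <= v)%N ->
  agree m (rare_word s u) (rare_word s v).
Proof.
move=> mu mv k km; rewrite /rare_word !modn_small; try lia.
by rewrite !ifF//; apply/eqP; lia.
Qed.

Lemma rare_word_neq s u v : (u < v)%N -> rare_word s u <> rare_word s v.
Proof.
move=> uv /(congr1 (@^~ u)); rewrite /rare_word !modn_small; try lia.
by rewrite eqxx ifF; [case: s|apply/eqP; lia].
Qed.

Lemma rare_word_periodic s u i : rare_word s u (u.+1 + i)%N = rare_word s u i.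
Proof. by rewrite /rare_word modnDl. Qed.

Lemma rare_word_adjacent s u i : (0 < u)%N ->
  rare_word s u i = s \/ rare_word s u i.+1 = s.
Proof.
move=> u0; rewrite /rare_word; case: eqP => [iu|]; [right|by left].
by rewrite ifF// -addn1 -modnDml iu addn1 modnn; apply/eqP; lia.
Qed.

Lemma middle_of_three (R : realType) (a b c : R) : a != b -> b != c -> a != c ->
  [\/ b < a < c \/ c < a < b, a < b < c \/ c < b < a | a < c < b \/ b < c < a].
Proof.
case: (ltgtP a b) => // ab _; case: (ltgtP b c) => // bc _;
  case: (ltgtP a c) => // ac _; try by [apply: Or31; lra|apply: Or32; lra|apply: Or33; lra].
Qed.

(** * No full shift inside a map with segments of periodic points *)

Section NoShift.
Context {R : realType} {F : R -> R} {c : R} (Fc : full_unimodal F c).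
Context (Fper : periodic_segments F).
Context (n : nat) (n_gt0 : (0 < n)%N) (e : cantor_space -> R).
Hypothesis e01 : forall x, 0 <= e x <= 1.
Hypothesis e_inj : injective e.
Hypothesis Fe_cont : forall i, continuous (fun x => iter i F (e x)).
Hypothesis e_shift : forall x, e (full_shift x) = iter n F (e x).

Let e_iter l x : e (iter l full_shift x) = iter (n * l) F (e x).
Proof.
elim: l => [|l IH]; first by rewrite muln0.
by rewrite iterS e_shift IH mulnS iterD.
Qed.

Let shift_eqP l x y : iter l full_shift x = y <-> forall k, x (l + k)%N = y k.
Proof.
rewrite iter_full_shift; split => [<-//|xy]; exact/funext.
Qed.

(** A point whose orbit meets the turning point [c] is sent to 1 and then to 0,
where it stays. By injectivity of [e] its sequence is then constant from the
position 2 on, and as [e] does not vanish at the constant sequence [s], the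
repeated symbol is not [s]. *)
Lemma turn_avoided s x i : e (fun=> s) != 0 -> (i < n)%N ->
  x 2 = s \/ x 3 = s -> iter i F (e x) != c.
Proof.
move=> es0 ltin xs; apply/eqP => xc.
have F0 m : iter m F 0 = 0 by elim: m => //= m ->; exact: unimodal0 Fc.
(* [i.+2 <= n * 2], because [i < n] *)
have e2 : e (iter 2 full_shift x) = 0.
  rewrite e_iter (_ : n * 2 = (n * 2 - i.+2) + i.+2)%N; last lia.
  by rewrite iterD !iterS xc (unimodal_turn Fc) (unimodal1 Fc) F0.
have x23 : iter 3 full_shift x = iter 2 full_shift x.
  by apply: e_inj; rewrite [in LHS]iterS e_shift e2 F0.
have xconst k : x (2 + k)%N = x 2.
  elim: k => // k <-; have := congr1 (@^~ k) x23.
  by rewrite !iter_full_shift addnS => <-.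
have x2s : x 2 = s by case: xs => // <-; rewrite -(xconst 1).
case/eqP: es0; rewrite -e2; congr e; apply/esym/shift_eqP => k.
by rewrite xconst.
Qed.

(** The sequence [x] consists of an even number of periods of the rare word followed
by [z]. The orbits of [x] and of the rare word stay together on the same side of
the turning point until [x] has become [z], so [x] is on the same side of the rare
word as [z], and as close to it as desired. *)
Lemma pull_back s M u z : (0 < u)%N ->
  (forall i x y, (i < n)%N -> (x 2 = s \/ x 3 = s) -> agree M x y ->
    same_side c (iter i F (e x)) (iter i F (e y))) ->
  agree M (rare_word s u) z -> z <> rare_word s u ->
  forall m, exists x, [/\ agree m (rare_word s u) x, x <> rare_word s u &
    (e x < e (rare_word s u)) = (e z < e (rare_word s u))].
Proof.
set q := rare_word s u => u0 side qz nqz m.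
pose p := u.+1; pose N := (p * (2 * m))%N.
have qp : iter p full_shift q = q by apply/shift_eqP => k; exact: rare_word_periodic.
have qN : iter N full_shift q = q.
  by rewrite /N; elim: (2 * m)%N => [|j IH]; rewrite ?muln0// mulnS iterD IH.
pose x : cantor_space := fun i => if (i < N)%N then q i else z (i - N)%N.
have xN : iter N full_shift x = z.
  by apply/shift_eqP => k; rewrite /x ltnNge leq_addr/= addKn.
have qx : agree (N + M) q x.
  move=> k kNM; rewrite /x; case: ltnP => // Nk.
  rewrite -qz; last by rewrite ltn_subLR.
  by rewrite -[in RHS]qN iter_full_shift subnKC.
have nxq : x <> q by move=> xq; apply: nqz; rewrite -xN xq qN.
exists x; split => //; first by apply: agreeW qx; rewrite /N; nia.
have exq : e x != e q by apply/eqP => /e_inj.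
have side' t : (t < n * N)%N -> same_side c (iter t F (e x)) (iter t F (e q)).
  move=> tnN; rewrite (divn_eq t n) addnC mulnC !iterD -!e_iter.
  set l := (t %/ n)%N.
  have lN : (l < N)%N by rewrite /l ltn_divLR// mulnC.
  suff : same_side c (iter (t %% n) F (e (iter l full_shift q)))
      (iter (t %% n) F (e (iter l full_shift x))).
    by case=> -[? ?]; [left|right].
  apply: side; first by rewrite ltn_mod.
    by rewrite !iter_full_shift; have := rare_word_adjacent s (l + 2) u0; rewrite -addnS.
  move=> k kM; rewrite !iter_full_shift qx//; lia.
have [_ ->] := same_side_order Fc (e01 x) (e01 q) side' exq.
rewrite -!e_iter xN qN (_ : n * N = (n * p) * (2 * m))%N; last by rewrite /N mulnA.
by rewrite flips_periodic// -e_iter qp.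
Qed.

Theorem no_shift_embedding : False.
Proof.
(* the fixed point 0 can be the image of only one of the constant sequences, and
   the symbol of the other one is made the frequent symbol *)
have [s es] : exists s, e (fun=> s) != 0.
  have [e0|] := eqVneq (e (fun=> true)) 0; last by exists true.
  exists false; apply/eqP => e1; have := e_inj (etrans e0 (esym e1)).
  by move=> /(congr1 (@^~ 0%N)).
have K4 x y : agree 4 x y -> (x 2 = s \/ x 3 = s) -> (y 2 = s \/ y 3 = s).
  by move=> xy; rewrite (xy 2 isT) (xy 3 isT).
have [M0 side0] := uniform_same_side_family Fe_cont K4
  (fun i x ltin xs => turn_avoided es ltin xs).
pose M := M0.+1.
have side i (x y : cantor_space) : (i < n)%N -> x 2 = s \/ x 3 = s -> agree M x y ->
    same_side c (iter i F (e x)) (iter i F (e y)).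
  by move=> ltin xs xy; apply: side0 => //; apply: agreeW xy.
have [u [z [z' [Mu qz qz' zq qz'q]]]] : exists u z z', [/\ (M <= u)%N,
    agree M (rare_word s u) z, agree M (rare_word s u) z',
    e z < e (rare_word s u) & e (rare_word s u) < e z'].
  have neq u v : (u < v)%N -> e (rare_word s u) != e (rare_word s v).
    by move=> uv; apply/eqP => /e_inj; exact: rare_word_neq.
  have [] := middle_of_three (neq _ _ (ltnSn M)) (neq _ _ (ltnSn M.+1))
    (neq _ _ (ltnW (ltnSn M.+1))).
  - case=> /andP[h1 h2]; exists M.
    + exists (rare_word s M.+1), (rare_word s M.+2).
      by split => //; try apply: rare_word_agree; lia.
    + exists (rare_word s M.+2), (rare_word s M.+1).
      by split => //; try apply: rare_word_agree; lia.
  - case=> /andP[h1 h2]; exists M.+1.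
    + exists (rare_word s M), (rare_word s M.+2).
      by split => //; try apply: rare_word_agree; lia.
    + exists (rare_word s M.+2), (rare_word s M).
      by split => //; try apply: rare_word_agree; lia.
  - case=> /andP[h1 h2]; exists M.+2.
    + exists (rare_word s M), (rare_word s M.+1).
      by split => //; try apply: rare_word_agree; lia.
    + exists (rare_word s M.+1), (rare_word s M).
      by split => //; try apply: rare_word_agree; lia.
set q := rare_word s u in qz qz' zq qz'q; set b := e q in zq qz'q.
pose p := u.+1.
have u0 : (0 < u)%N by exact: leq_trans Mu.
have qp : iter p full_shift q = q by apply/shift_eqP => k; exact: rare_word_periodic.
have bp : iter (n * p) F b = b by rewrite -e_iter qp.
have b01 : 0 < b <= 1.
  have /andP[z0 _] := e01 z; have /andP[_ b1] := e01 q.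
  by rewrite (le_lt_trans z0 zq).
have np0 : (0 < n * p)%N by rewrite muln_gt0 n_gt0.
have [v [w [vw /andP[vb bw] Fvw]]] := Fper np0 b01 bp.
(* a sequence near [q] whose image falls in the segment has the period of [q]
   twice repeated, and its first two periods are those of [q] *)
have stuck x : agree (2 * p) q x -> x <> q -> ~ (v <= e x <= w).
  move=> qx nxq /Fvw; rewrite mulnCA -e_iter => /e_inj /shift_eqP xp.
  apply: nxq; apply/funext => k; elim/ltn_ind: k => k IH.
  have [kp|pk] := ltnP k (2 * p); first by rewrite qx.
  rewrite -(subnKC pk) xp IH; last by rewrite /p; lia.
  move: (k - _)%N => k'; rewrite /q /p mul2n -addnn -addnA.
  by rewrite !rare_word_periodic.
have near_q (d : R) : 0 < d -> exists m, forall x, agree m q x -> `|e x - b| < d.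
  move=> d0; have : nbhs q [set x | `|e x - b| < d].
    have /cvgrPdist_lt /(_ d d0) := @Fe_cont 0%N q.
    by apply: filterS => x /=; rewrite distrC.
  by move=> /agree_basis[m mP]; exists m.
have [bw'|wb] := ltP b w.
  have [m mP] := near_q (w - b) ltac:(by rewrite subr_gt0).
  have [|x [qx nxq]] := @pull_back s M u z' u0 side qz' _ (maxn m (2 * p)).
    by move=> z'q; move: qz'q; rewrite z'q ltxx.
  rewrite -/q -/b (lt_gtF qz'q) => xb.
  apply: (stuck x) => //; first by apply: agreeW qx; rewrite leq_maxr.
  have {}mP := mP x (agreeW (leq_maxl _ _) qx).
  have {}xb : b <= e x by rewrite leNgt xb.
  by move: mP; rewrite ger0_norm; lra.
have [m mP] := near_q (b - v) ltac:(by rewrite subr_gt0; lra).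
have [|x [qx nxq]] := @pull_back s M u z u0 side qz _ (maxn m (2 * p)).
  by move=> zq'; move: zq; rewrite zq' ltxx.
rewrite -/q -/b zq => xb.
apply: (stuck x) => //; first by apply: agreeW qx; rewrite leq_maxr.
have {}mP := mP x (agreeW (leq_maxl _ _) qx).
by move: mP; rewrite ltr0_norm; lra.
Qed.

End NoShift.

(** * The map on the unit interval *)

Section IntervalMap.
Context {R : realType} (F : R -> R) (c : R) (Fc : full_unimodal F c).
Notation I := (unit_interval R).

Let val_itv (x : I) : 0 <= set_val x <= 1.
Proof. by have := set_valP x; rewrite /= in_itv. Qed.

Definition to_unit (y : R) (y01 : 0 <= y <= 1) : I :=
  SigSub (mem_set (y01 : (`[0, 1]%classic : set R) y)).

Definition interval_map (x : I) : I := to_unit (unimodal_itv Fc (val_itv x)).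

Lemma val_iter_interval_map n x : set_val (iter n interval_map x) = iter n F (set_val x).
Proof. by elim: n => //= n <-. Qed.

Lemma unimodal_continuous : {within `[0, 1], continuous F}.
Proof.
have [c0 c1] := andP (turn_itv Fc).
have -> : `[0, 1]%classic = `[0, c] `|` `[c, 1] :> set R.
  apply/seteqP; split => x /=; rewrite !in_itv/=; first by case: (leP x c); [left|right]; lra.
  by case; lra.
apply: withinU_continuous; [exact: itv_closed|exact: itv_closed| |].
  apply: segment_inc_surj_continuous.
    by apply: le_mono_in; exact: unimodal_inc Fc.
  move=> z; rewrite (unimodal0 Fc) (unimodal_turn Fc) /= in_itv/= => z01.
  by have [y yc <-] := unimodal_surjl Fc z01; exists y; rewrite //= in_itv.
apply: segment_dec_surj_continuous.
  by apply: le_nmono_in; exact: unimodal_dec Fc.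
move=> z; rewrite (unimodal1 Fc) (unimodal_turn Fc) /= in_itv/= => z01.
by have [y yc <-] := unimodal_surjr Fc z01; exists y; rewrite //= in_itv.
Qed.

Lemma interval_map_continuous : continuous interval_map.
Proof.
have /subspace_sigL_continuousP cF := unimodal_continuous.
apply/continuousP => _ [B oB <-].
by move/continuousP : cF => /(_ B oB).
Qed.

Lemma interval_map_surj : range interval_map = [set: I].
Proof.
apply/seteqP; split => // z _; have [y yc Fy] := unimodal_surjl Fc (val_itv z).
have y01 : 0 <= y <= 1 by have := turn_itv Fc; lra.
by exists (to_unit y01) => //; apply: val_inj; rewrite /= Fy.
Qed.

(** The left branch maps a point [a < c] to [c]. Going back first along the left
branch leads to a point of [[0, c]], and from there the two branches lead to
[[0, a]] and to [[c, 1]]: this is a horseshoe for the second iterate, with a gap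
of [c - a] between its two legs. *)
Lemma interval_map_entropy : (0 < topological_entropy interval_map)%E.
Proof.
have [c0 c1] := andP (turn_itv Fc).
have c01 : 0 <= c <= 1 by lra.
have [a ac Fa] := unimodal_surjl Fc c01.
have a_lt_c : a < c.
  rewrite lt_neqAle; case/andP: ac => _ ->; rewrite andbT.
  by apply/eqP => aE; move: Fa; rewrite aE (unimodal_turn Fc); lra.
have lift (P : R -> Prop) : (forall z, 0 <= z <= c -> exists2 y, P y & 0 <= y <= 1 /\ F y = z) ->
    exists2 h : I -> I, cancel h (iter 2 interval_map) & forall x, P (set_val (h x)).
  move=> H; have /choice[h hP] : forall x : I, exists y : I,
      iter 2 interval_map y = x /\ P (set_val y).
    move=> x; have [z zc Fz] := unimodal_surjl Fc (val_itv x).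
    have [y Py [y01 Fy]] := H z zc.
    exists (to_unit y01); split => //; apply: val_inj.
    by apply: etrans (val_iter_interval_map 2 (to_unit y01)) _; rewrite /= Fy Fz.
  by exists h => x; have [] := hP x.
have [h0 h0K h0a] : exists2 h : I -> I, cancel h (iter 2 interval_map) &
    forall x, set_val (h x) <= a.
  apply: (lift (fun y => y <= a)) => z zc; have z01 : 0 <= z <= 1 by lra.
  have [y yc Fy] := unimodal_surjl Fc z01.
  exists y; last by split => //; lra.
  rewrite leNgt; apply/negP => ay.
  have := unimodal_inc Fc _ _ ay; rewrite !in_itv/= Fa Fy => /(_ ac yc); lra.
have [h1 h1K h1c] : exists2 h : I -> I, cancel h (iter 2 interval_map) &
    forall x, c <= set_val (h x).
  apply: (lift (fun y => c <= y)) => z zc; have z01 : 0 <= z <= 1 by lra.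
  have [y yc Fy] := unimodal_surjr Fc z01.
  by exists y; [|split => //]; lra.
apply: (horseshoe_entropy (isT : (0 < 2)%N) (to_unit c01) h0K h1K (e := c - a)).
  by rewrite subr_gt0.
move=> x y; change (~ ball (set_val (h0 x)) (c - a) (set_val (h1 y))).
rewrite -ball_normE /ball_/= => xy.
have := h0a x; have := h1c y; move: xy; rewrite distrC ltr_norml; lra.
Qed.

(** The inverse of a conjugacy, followed by the inclusions, is an embedding of the
Cantor space of the kind excluded by [no_shift_embedding]. *)
Lemma interval_map_no_shift n (X : set I) : periodic_segments F -> (0 < n)%N ->
  forall fnX : iter n interval_map @` X `<=` X,
  ~ topologically_conjugate (restrict_map fnX) full_shift.
Proof.
move=> Fper n0 fnX [phi [[_ [psi [psic phiK psiK]]] conj]].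
pose e' (w : cantor_space) : I := set_val (psi w).
have e'c : continuous e'.
  move=> w; apply: (@continuous_comp _ _ _ psi set_val); first exact: psic.
  exact: initial_continuous.
apply: (no_shift_embedding Fc Fper n0 (e := fun w => set_val (e' w))).
- by move=> w; exact: val_itv.
- by move=> w w' /val_inj/val_inj /(congr1 phi); rewrite !psiK.
- move=> i.
  have -> : (fun x => iter i F (set_val (e' x))) =
      set_val \o (iter i interval_map \o e').
    by apply/funext => w /=; rewrite val_iter_interval_map.
  move=> w; apply: continuous_comp; last exact: initial_continuous.
  apply: continuous_comp; first exact: e'c.
  elim: i => [|i IH]; first exact: cvg_id.
  by apply: continuous_comp => //; exact: interval_map_continuous.
- move=> w; have /(congr1 (@^~ (psi w))) /= := conj; rewrite psiK => <-.
  by rewrite /e' phiK /= val_iter_interval_map.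
Qed.

End IntervalMap.

Theorem theorem1p3 (R : realType) :
  exists f : unit_interval R -> unit_interval R,
    [/\ continuous f,
        range f = [set: unit_interval R],
        (0 < topological_entropy f)%E &
        forall (n : nat) (X : set (unit_interval R)),
          (0 < n)%N -> closed X ->
          forall fnX : iter n f @` X `<=` X,
            ~ topologically_conjugate (restrict_map fnX) full_shift].
Proof.
have [F [c [Fc Fper]]] := @exists_unimodal_periodic_segments R.
exists (interval_map Fc); split.
- exact: interval_map_continuous.
- exact: interval_map_surj.
- exact: interval_map_entropy.
- by move=> n X n0 _ fnX; exact: interval_map_no_shift.
Qed.
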